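(* Let $X_1,\dots,X_n$ be independent centered real random variables. Define $$Z=\sum_{i=1}^nX_i,\qquad \sigma^2=\sum_{i=1}^n\mathbb{E}[X_i^2],\qquad Y=\max_{1\le i\le n}|X_i| .$$ Then for any integer $q\ge2$ and any $\theta\in(0,1)$, $$\|(Z)_+\|_q\le\sigma\sqrt{2\kappa(2+\theta)q}+q\kappa\sqrt{1+\frac1\theta}\;\|Y\|_q .$$
   Context: $x_+=\max(x,0)$, $\|Y\|_q=(\mathbb{E}|Y|^q)^{1/q}$ (possibly $+\infty$), and $\kappa=\frac{\sqrt e}{2(\sqrt e-1)}<1.271$. Centered means integrable with mean $0$. *)

(* Defs.v *)
From HB Require Import structures.
From mathcomp Require Import all_boot all_order all_algebra.
From mathcomp Require Import all_classical all_reals all_analysis.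

Set Implicit Arguments.
Unset Strict Implicit.
Unset Printing Implicit Defensive.

Import Order.TTheory GRing.Theory Num.Theory.
Import numFieldNormedType.Exports.

Local Open Scope classical_set_scope.
Local Open Scope ring_scope.

(* Only the B i with i in J matter; J = set0 gives the trivial P setT = 1. *)
Definition mutually_independent (d : measure_display) (T : measurableType d)
    (R : realType) (P : probability T R) (I : finType)
    (X : I -> {RV P >-> R}) : Prop :=
  forall (J : {set I}) (B : I -> set R),
    (forall i, measurable (B i)) ->
    P (\bigcap_(i in [set` J]) (X i @^-1` B i)) =
      (\prod_(i in J) P (X i @^-1` B i))%E.

(* Integrability is stated explicitly: the library's expectation is total, so
   'E_P[X] = 0 alone does not imply it. *)
Definition centered (d : measure_display) (T : measurableType d)
    (R : realType) (P : probability T R) (X : {RV P >-> R}) : Prop :=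
  P.-integrable [set: T] (EFin \o X) /\ ('E_P[X] = 0)%E.

Definition kappa (R : realType) : R :=
  Num.sqrt (expR 1) / (2 * (Num.sqrt (expR 1) - 1)).

(* Main.v *)
Require Import Defs.
From HB Require Import structures.
From mathcomp Require Import all_boot all_order all_algebra.
From mathcomp Require Import all_classical all_reals all_analysis.
From mathcomp Require Import measurable_realfun.
From mathcomp Require Import ring lra.

Import Order.TTheory GRing.Theory Num.Theory.
Import numFieldNormedType.Exports.

Local Open Scope classical_set_scope.
Local Open Scope ring_scope.

(** Why the bound holds.  Write [q = m + 2], [z_+] for the positive part,
    [S_i = Z - X_i], [U] for the Euclidean norm of the vector of the [X_j],
    [V_i] for that norm with [X_i] left out, and [s2] for the sum of the
    second moments.  The idea is to decouple one summand at a time.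

    As [X_i] is centered and independent of [S_i], the product
    [X_i (S_i)_+^(q-1)] has mean zero, so that
      [E Z_+^q = sum_i E X_i Z_+^(q-1)
               = sum_i E X_i (Z_+^(q-1) - (S_i)_+^(q-1))].
    The tangent inequality for the convex power bounds each increment by
    [(q-1) X_i^2 (Z_+^(q-2) + (S_i)_+^(q-2))].  In the second term [X_i^2] and
    [S_i] are independent, and [E (S_i)_+^(q-2) <= E Z_+^(q-2)] by Jensen's
    inequality.  Hence ([pos_sum_moment_le])
      [E Z_+^q <= (q-1) (E U^2 Z_+^(q-2) + s2 E Z_+^(q-2))].
    The same decoupling applied to [U^q = sum_i X_i^2 U^(q-2)] against
    [X_i^2 V_i^(q-2)] gives ([euclidean_norm_moment_le])
      [E U^q <= s2 E U^(q-2) + (q-2) E Y^2 U^(q-2)].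
    By Hoelder's inequality ([young_Rintegral]) these self-bounding relations
    become [|Z_+|_q^2 <= (q-1) (|U|_q^2 + s2)] and
    [|U|_q^2 <= s2 + (q-2) |Y|_q^2], whence ([pos_sum_norm_le])
      [|Z_+|_q^2 <= (q-1) (2 s2 + (q-2) |Y|_q^2)],
    which is below the square of the announced bound because [kappa >= 1].

    Finiteness: if [E Y^q] is infinite there is nothing to prove.  Otherwise
    every function that occurs is dominated by a multiple of [Y^k] for some
    [k <= q], hence integrable; the predicate [growth] keeps track of [k]. *)

(** * Independence of one variable from the others *)

Section independence.
Set Implicit Arguments.
Unset Strict Implicit.
Context (d : measure_display) (T : measurableType d) (R : realType).
Variable P : probability T R.

Definition independent_pair (X V : T -> R) : Prop :=
  forall A B : set R, measurable A -> measurable B ->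
    P (X @^-1` A `&` V @^-1` B) = (P (X @^-1` A) * P (V @^-1` B))%E.

(** The joint law of an independent pair is the product of the two laws, so
    this is Tonelli's theorem. *)
Lemma independent_pair_expectationM (X V : {mfun T >-> R}) (f g : R -> R) :
  independent_pair X V ->
  measurable_fun [set: R] f -> measurable_fun [set: R] g ->
  (forall x, 0 <= f x) -> (forall x, 0 <= g x) ->
  (\int[P]_w (f (X w) * g (V w))%:E =
   \int[P]_w (f (X w))%:E * \int[P]_w (g (V w))%:E)%E.
Proof.
move=> XV mf mg f0 g0.
have mXV : measurable_fun [set: T] (fun w => (X w, V w)).
  exact: measurable_fun_pair.
pose F (z : R * R) := (f z.1 * g z.2)%:E.
have mF : measurable_fun setT F.
  apply/measurable_EFinP; apply: measurable_funM.
    exact: (measurableT_comp mf measurable_fst).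
  exact: (measurableT_comp mg measurable_snd).
have F0 z : (0 <= F z)%E by rewrite lee_fin mulr_ge0.
transitivity (\int[pushforward P (fun w => (X w, V w))]_z F z)%E.
  by rewrite ge0_integral_pushforward.
rewrite -(@eq_measure_integral _ _ _ _ _
  (distribution P X \x distribution P V)%E).
  rewrite fubini_tonelli1//= /fubini_F.
  have intF x : (\int[distribution P V]_y F (x, y) =
      (f x)%:E * \int[distribution P V]_y (g y)%:E)%E.
    rewrite /F /=; under eq_integral do rewrite EFinM.
    rewrite ge0_integralZl_EFin//; last exact/measurable_EFinP.
    by move=> y _; rewrite lee_fin.
  under eq_integral do rewrite intF.
  rewrite ge0_integralZr//; [|exact/measurable_EFinP|..].
  - rewrite ge0_integral_distribution//; last exact/measurable_EFinP.
    by rewrite ge0_integral_distribution//; exact/measurable_EFinP.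
  - by move=> x _; rewrite lee_fin.
  - by apply: integral_ge0 => y _; rewrite lee_fin.
by move=> C mC _; exact: product_measure_unique.
Qed.

Section one_against_the_others.
Context (I : finType) (X : I -> {RV P >-> R}) (i : I).
Hypothesis indX : mutually_independent X.

(** The cylinder events of the family with [X i] left out: a pi-system that
    generates the sigma-algebra of these variables. *)
Definition others_cylinders : set (set T) :=
  [set C | exists2 B : I -> set R, (forall j, measurable (B j)) &
    C = \bigcap_(j in [set` [set~ i]%SET]) (X j @^-1` B j)].

Lemma others_cylinders_measurable : others_cylinders `<=` measurable.
Proof.
move=> _ [B mB ->]; apply: fin_bigcap_measurable => //.
by move=> j _; rewrite -[_ @^-1` _]setTI; exact: measurable_funP.
Qed.

Lemma others_cylinders_setI : setI_closed others_cylinders.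
Proof.
move=> _ _ [B mB ->] [C mC ->]; exists (fun j => B j `&` C j).
  by move=> j; exact: measurableI.
by rewrite -bigcapI.
Qed.

Lemma others_cylinders_setT : others_cylinders setT.
Proof.
exists (fun=> setT) => //; apply/esym.
by rewrite -subTset => w _ j _.
Qed.

(** For fixed [A], both sides are finite measures in [E]; they agree on the
    cylinders by mutual independence, hence on the generated sigma-algebra. *)
Lemma independent_of_others (A : set R) (E : set T) : measurable A ->
  <<s others_cylinders >> E ->
  P (X i @^-1` A `&` E) = (P (X i @^-1` A) * P E)%E.
Proof.
move=> mA sE.
have mXA : measurable (X i @^-1` A).
  by rewrite -[_ @^-1` _]setTI; exact: measurable_funP.
have p0 : 0 <= fine (P (X i @^-1` A)) by rewrite fine_ge0.
rewrite setIC -[LHS]/(mrestr P mXA E).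
rewrite -[P (X i @^-1` A)]fineK ?fin_num_measure//.
rewrite -[RHS]/(mscale (NngNum p0) P E).
apply: (g_sigma_algebra_measure_unique others_cylinders _ (fun=> setT)) sE
  => //.
- exact: others_cylinders_measurable.
- by move=> _; exact: others_cylinders_setT.
- by rewrite bigcup_const.
- exact: others_cylinders_setI.
- move=> _ [B mB ->] /=.
  rewrite /mrestr /mscale /= fineK ?fin_num_measure//.
  (* A cylinder cut by the event on [X i] is a cylinder of the whole family. *)
  pose C j := if j == i then A else B j.
  have mC j : measurable (C j) by rewrite /C; case: ifP.
  have Ci : C i = A by rewrite /C eqxx.
  have CB j : j \in [set~ i]%SET -> C j = B j.
    by rewrite !inE /C => /negbTE ->.
  have -> : \bigcap_(j in [set` [set~ i]%SET]) (X j @^-1` B j) =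
      \bigcap_(j in [set` [set~ i]%SET]) (X j @^-1` C j).
    by apply: eq_bigcapr => j /= /CB ->.
  have -> :
      \bigcap_(j in [set` [set~ i]%SET]) (X j @^-1` C j) `&` X i @^-1` A =
      \bigcap_(j in [set` [set: I]%SET]) (X j @^-1` C j).
    apply/seteqP; split=> w.
      move=> [wC wA] j _; have [->|ji] := eqVneq j i; first by rewrite /= Ci.
      by apply: wC; rewrite /= !inE.
    move=> wC; split; last by rewrite -Ci; apply: wC; rewrite /= inE.
    by move=> j _; apply: wC; rewrite /= inE.
  rewrite (indX [set: I]%SET mC) (indX [set~ i]%SET mC).
  rewrite (bigD1 i) ?inE//= Ci; congr (_ * _)%E.
  by apply: eq_bigl => j; rewrite !inE.
- move=> _; rewrite /= /mrestr setTI.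
  by rewrite -ge0_fin_numE ?fin_num_measure.
Qed.

Let others := g_sigma_algebraType others_cylinders.

Lemma measurable_other (j : I) : j != i ->
  measurable_fun [set: others] (X j : others -> R).
Proof.
move=> ji _ B mB; apply: sub_sigma_algebra; rewrite setTI.
exists (fun k => if k == j then B else setT); first by move=> k; case: ifP.
apply/seteqP; split=> w /=.
  by move=> Bw k _ /=; case: eqVneq => // ->.
by move=> /(_ j); rewrite /= !inE eqxx; exact.
Qed.

Lemma independent_pair_others (V : T -> R) :
  measurable_fun [set: others] (V : others -> R) -> independent_pair (X i) V.
Proof.
move=> mV A B mA mB; apply: independent_of_others => //.
by rewrite -[_ @^-1` _]setTI; exact: mV.
Qed.

Lemma independent_pair_sum_others (h : R -> R) : measurable_fun [set: R] h ->
  independent_pair (X i) (fun w => \sum_(j | j != i) h (X j w)).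
Proof.
move=> mh; apply: independent_pair_others.
have -> : (fun w => \sum_(j | j != i) h (X j w)) =
    (fun w : others => \sum_j (if j != i then h (X j w) else 0)).
  by apply/funext => w; rewrite big_mkcond.
apply: measurable_sum => j; case: eqVneq => [_|ji] //=.
exact: (measurableT_comp mh (measurable_other ji)).
Qed.

End one_against_the_others.
End independence.

(** * Pointwise inequalities for powers *)

Section pointwise.
Set Implicit Arguments.
Unset Strict Implicit.
Context (R : realType).
Implicit Types (a b s x y : R) (k m : nat).

(** Convexity: a power lies above its tangent at [b]. *)
Lemma expr_tangent a b k : 0 <= a -> 0 <= b ->
  b ^+ k.+1 - a ^+ k.+1 <= k.+1%:R * b ^+ k * (b - a).
Proof.
move=> a0 b0; elim: k => [|k IH]; first by rewrite !expr1 expr0 !mul1r.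
have mono : 0 <= (b - a) * (b ^+ k.+1 - a ^+ k.+1).
  have [ab|ba] := leP a b.
    by rewrite mulr_ge0 ?subr_ge0// lerXn2r ?nnegrE.
  by rewrite mulr_le0 ?subr_le0 ?(ltW ba)// lerXn2r ?nnegrE// ltW.
have := ler_wpM2l b0 IH.
rewrite -[in X in _ -> X]natr1 (exprS b k.+1) (exprS a k.+1) (exprS b k).
move: mono; rewrite (exprS b k); set A := a ^+ k.+1; set B := b ^+ k.
set K := _%:R; nra.
Qed.

(** Young's inequality with exponents [q / 2] and [q / m], where [q = m + 2], in
    a form that keeps all powers natural and includes [m = 0].  The step from
    [m] to [m + 1] multiplies by [y] and adds [mono] below, a product of two
    factors of the same sign. *)
Lemma young_sqr_expr x y m : 0 <= x -> 0 <= y ->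
  m.+2%:R * (x ^+ 2 * y ^+ m) <= 2 * x ^+ m.+2 + m%:R * y ^+ m.+2.
Proof.
move=> x0 y0; elim: m => [|m IH]; first by rewrite expr0 mulr1 mul0r addr0.
have mono : 0 <= (x - y) * (2 * x ^+ m.+2 - (x + y) * y ^+ m.+1).
  have [yx|xy] := leP y x.
    rewrite mulr_ge0 ?subr_ge0//.
    have : y ^+ m.+1 <= x ^+ m.+1 by rewrite lerXn2r ?nnegrE.
    have : 0 <= y ^+ m.+1 by rewrite exprn_ge0.
    rewrite (exprS x m.+1); nra.
  rewrite mulr_le0 ?subr_le0 ?(ltW xy)//.
  have : x ^+ m.+1 <= y ^+ m.+1 by rewrite lerXn2r ?nnegrE// ltW.
  have : 0 <= x ^+ m.+1 by rewrite exprn_ge0.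
  rewrite (exprS x m.+1); nra.
have := ler_wpM2l y0 IH; move: mono.
rewrite -(@natr1 _ m.+2) -(@natr1 _ m) (exprS x m.+2) (exprS y m.+2).
rewrite (exprS y m.+1) (exprS y m) -(@natr1 _ m.+1) -(@natr1 _ m).
set A := x ^+ m.+2; set B := y ^+ m; set K := m%:R; nra.
Qed.

Definition pos s := Num.max s 0.

Lemma pos_ge0 s : 0 <= pos s.
Proof. by rewrite le_max lexx orbT. Qed.

(** The tangent of the power is taken at the larger of [pos (s + x)] and
    [pos s], which depends on the sign of [x]; the two terms on the right
    cover the two cases. *)
Lemma pos_increment s x m :
  x * pos (s + x) ^+ m.+1 <= x * pos s ^+ m.+1
    + m.+1%:R * (x ^+ 2 * pos (s + x) ^+ m + x ^+ 2 * pos s ^+ m).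
Proof.
have B0 := pos_ge0 (s + x); have A0 := pos_ge0 s.
have Bm : 0 <= m.+1%:R * pos (s + x) ^+ m by rewrite mulr_ge0// exprn_ge0.
have Am : 0 <= m.+1%:R * pos s ^+ m by rewrite mulr_ge0// exprn_ge0.
have [x0|x0] := leP 0 x.
  have := expr_tangent m A0 B0.
  have : pos (s + x) - pos s <= x.
    by rewrite /pos; case: (leP s 0); case: (leP (s + x) 0); lra.
  have : 0 <= x ^+ 2 by rewrite sqr_ge0.
  move: Bm Am; set A := pos s ^+ m.+1; set B := pos _ ^+ m.+1.
  set A' := pos s ^+ m; set B' := pos _ ^+ m; set K := m.+1%:R.
  set D := pos _ - _ => Bm Am x2 D1 t.
  have : x * (K * B' * D) <= x * (K * B' * x) by rewrite ler_wpM2l// ler_wpM2l.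
  have : x * (B - A) <= x * (K * B' * D) by rewrite ler_wpM2l.
  nra.
have := expr_tangent m B0 A0.
have : pos s - pos (s + x) <= - x.
  by rewrite /pos; case: (leP s 0); case: (leP (s + x) 0); lra.
have : 0 <= x ^+ 2 by rewrite sqr_ge0.
move: Bm Am; set A := pos s ^+ m.+1; set B := pos _ ^+ m.+1.
set A' := pos s ^+ m; set B' := pos _ ^+ m; set K := m.+1%:R.
set D := pos _ - _ => Bm Am x2 D1 t.
have nx : 0 <= - x by lra.
have : - x * (K * A' * D) <= - x * (K * A' * - x).
  by rewrite ler_wpM2l// ler_wpM2l.
have : - x * (A - B) <= - x * (K * A' * D) by rewrite ler_wpM2l.
nra.
Qed.

(** A subgradient at [s] of [fun t => pos t ^+ m].  The simpler formula
    [m%:R * pos s ^+ m.-1] fails for [m = 1], where it is 1 at negative [s]. *)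
Definition pos_slope m s := if 0 < s then m%:R * s ^+ m.-1 else 0.

Lemma pos_slope_ge0 m s : 0 <= pos_slope m s.
Proof.
by rewrite /pos_slope; case: ifP => // s0; rewrite mulr_ge0// exprn_ge0// ltW.
Qed.

Lemma pos_subgradient m s x :
  pos s ^+ m + x * pos_slope m s <= pos (s + x) ^+ m.
Proof.
case: m => [|m]; first by rewrite /pos_slope mul0r if_same mulr0 addr0 !expr0.
have B0 := pos_ge0 (s + x).
rewrite /pos_slope; case: ltP => s0; last first.
  by rewrite mulr0 addr0 /pos (max_r s0) expr0n exprn_ge0.
have Bx : s + x <= pos (s + x) by rewrite le_max lexx.
rewrite [pos s]max_l ?(ltW s0)//=.
have := expr_tangent m B0 (ltW s0).
have : 0 <= m.+1%:R * s ^+ m by rewrite mulr_ge0// exprn_ge0// ltW.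
set C := m.+1%:R * _; set A := s ^+ m.+1; set B := _ ^+ m.+1.
nra.
Qed.

(** By the tangent inequality [u^m - v^m] is at most [m u^(m-1) (u - v)], and
    [u (u - v) <= u^2 - v^2 = w]. *)
Lemma norm_increment (u v w : R) m : 0 <= u -> 0 <= v -> 0 <= w ->
  u ^+ 2 = w + v ^+ 2 ->
  u ^+ 2 * (u ^+ m - v ^+ m) <= m%:R * (w * u ^+ m).
Proof.
move=> u0 v0 w0 uvw; case: m => [|m]; first by rewrite !expr0 subrr mulr0 mul0r.
have vu : v <= u.
  by rewrite -(@ler_pXn2r _ 2) ?nnegrE// uvw lerDr.
apply: (@le_trans _ _ (u ^+ 2 * (m.+1%:R * u ^+ m * (u - v)))).
  by rewrite ler_wpM2l ?sqr_ge0// expr_tangent.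
rewrite (exprS u m).
have : u * (u - v) <= w.
  have : v * v <= v * u by rewrite ler_wpM2l.
  move: uvw; rewrite !expr2; nra.
have : 0 <= m.+1%:R * u ^+ m * u by rewrite !mulr_ge0// exprn_ge0.
move=> /ler_wpM2l /[apply]; set C := u ^+ m; set K := m.+1%:R.
rewrite expr2; nra.
Qed.

(** Equivalent to [sqrt e <= 2], which follows from
    [1 - 1/2 <= exp (- 1/2)]. *)
Lemma kappa_ge1 : 1 <= kappa R.
Proof.
have e1 : 1 < Num.sqrt (expR 1) :> R.
  by rewrite -[ltLHS]sqrtr1 ltr_sqrt ?expR_gt0// expR_gt1.
have e2 : Num.sqrt (expR 1) <= 2 :> R.
  have e : expR 2^-1 ^+ 2 = expR 1 :> R.
    by rewrite -expRM_natl -mulr_natl mulfV.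
  rewrite -e sqrtr_sqr ger0_norm ?expR_ge0//.
  have := expR_ge1Dx (- 2^-1 : R); rewrite expRN.
  move=> /(ler_wpM2l (expR_ge0 2^-1)); rewrite mulfV ?gt_eqF ?expR_gt0//; lra.
rewrite /kappa ler_pdivlMr; lra.
Qed.

End pointwise.

(** * Real-valued expectations *)

Section integration.
Set Implicit Arguments.
Unset Strict Implicit.
Context (d : measure_display) (T : measurableType d) (R : realType).
Variable P : probability T R.
Implicit Types (f g : T -> R).

Local Notation integrable f := (P.-integrable [set: T] (EFin \o f)).

Lemma integrableZ_EFin (k : R) f :
  integrable f -> integrable (fun w => k * f w).
Proof.
move=> intf.
have -> : EFin \o (fun w => k * f w) = (fun w => k%:E * (EFin \o f) w)%E by [].
exact: integrableZl.
Qed.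

Lemma integrableD_EFin f g : integrable f -> integrable g ->
  integrable (fun w => f w + g w).
Proof.
move=> intf intg.
have -> : EFin \o (fun w => f w + g w) = ((EFin \o f) \+ (EFin \o g))%E by [].
exact: integrableD.
Qed.

Lemma integrable_sum_EFin (I : eqType) (s : seq I) (f : I -> T -> R) :
  (forall i, integrable (f i)) -> integrable (fun w => \sum_(i <- s) f i w).
Proof.
move=> intf; have -> : EFin \o (fun w => \sum_(j <- s) f j w) =
    (fun w => \sum_(j <- s) (EFin \o f j) w)%E.
  by apply/funext => w /=; rewrite sumEFin.
exact: integrable_sum.
Qed.

Lemma Rintegral_sum (I : eqType) (s : seq I) (f : I -> T -> R) :
  (forall i, integrable (f i)) ->
  \int[P]_w (\sum_(i <- s) f i w) = \sum_(i <- s) \int[P]_w f i w.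
Proof.
move=> intf; elim: s => [|i s IH].
  under eq_Rintegral do rewrite big_nil.
  by rewrite Rintegral_cst// mul0r big_nil.
under eq_Rintegral do rewrite big_cons.
by rewrite RintegralD ?IH ?big_cons//; exact: integrable_sum_EFin.
Qed.

Lemma EFin_Rintegral f : integrable f ->
  (\int[P]_w f w)%:E = (\int[P]_w (f w)%:E)%E.
Proof.
by move=> intf; rewrite /Rintegral fineK//; exact: integrable_fin_num.
Qed.

Lemma independent_pair_Rintegral_ge0M (X : {RV P >-> R}) (V : T -> R)
    (f g : R -> R) :
  measurable_fun [set: T] V -> independent_pair P X V ->
  measurable_fun [set: R] f -> measurable_fun [set: R] g ->
  (forall x, 0 <= f x) -> (forall x, 0 <= g x) ->
  integrable (f \o X) -> integrable (g \o V) ->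
  \int[P]_w (f (X w) * g (V w)) = \int[P]_w f (X w) * \int[P]_w g (V w).
Proof.
move=> mV XV mf mg f0 g0 intf intg; rewrite {1}/Rintegral.
pose mVmixin := isMeasurableFun.Build _ _ _ _ V mV.
pose V' : {mfun T >-> R} := HB.pack V mVmixin.
have := @independent_pair_expectationM _ _ _ _ X V' f g XV mf mg f0 g0 => ->.
by rewrite fineM//; exact: integrable_fin_num.
Qed.

(** The product rule for nonnegative functions, applied to the positive and
    the negative part of [X], which have the same mean. *)
Lemma centered_Rintegral_mul0 (X : {RV P >-> R}) (V : T -> R) (g : R -> R) :
  centered X -> measurable_fun [set: T] V -> independent_pair P X V ->
  measurable_fun [set: R] g -> (forall x, 0 <= g x) ->
  integrable (g \o V) -> integrable (fun w => X w * g (V w)) ->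
  \int[P]_w (X w * g (V w)) = 0.
Proof.
move=> [intX EX0] mV XV mg g0 intg intXg.
have mpos : measurable_fun [set: R] (@pos R) by exact: measurable_maxr.
have mneg : measurable_fun [set: R] (fun x => pos (- x)).
  exact: (measurableT_comp mpos).
have posB (x : R) : x = pos x - pos (- x).
  by rewrite /pos; case: (leP x 0); case: (leP (- x) 0); lra.
have mg' : measurable_fun setT (g \o V) by exact: (measurableT_comp mg).
have ipos : integrable (@pos R \o X).
  apply: le_integrable intX => //.
    by apply/measurable_EFinP; exact: (measurableT_comp mpos).
  move=> w _; rewrite lee_fin /= ger0_norm ?pos_ge0// /pos.
  by rewrite ge_max ler_norm normr_ge0.
have ineg : integrable (fun w => pos (- X w)).
  apply: le_integrable intX => //.
    by apply/measurable_EFinP; exact: (measurableT_comp mneg).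
  move=> w _; rewrite lee_fin /= ger0_norm ?pos_ge0// /pos.
  by rewrite ge_max -[X in _ <= X]normrN ler_norm normr_ge0.
have iposg : integrable (fun w => pos (X w) * g (V w)).
  apply: le_integrable intXg => //.
    apply/measurable_EFinP/measurable_funM => //.
    exact: (measurableT_comp mpos).
  move=> w _; rewrite lee_fin /= !normrM ler_wpM2r// ger0_norm ?pos_ge0// /pos.
  by rewrite ge_max ler_norm normr_ge0.
have inegg : integrable (fun w => pos (- X w) * g (V w)).
  apply: le_integrable intXg => //.
    apply/measurable_EFinP/measurable_funM => //.
    exact: (measurableT_comp mneg).
  move=> w _; rewrite lee_fin /= !normrM ler_wpM2r// ger0_norm ?pos_ge0// /pos.
  by rewrite ge_max -[X in _ <= X]normrN ler_norm normr_ge0.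
have E0 : \int[P]_w pos (X w) - \int[P]_w pos (- X w) = 0.
  rewrite -RintegralB//; under eq_Rintegral do rewrite -posB.
  by move: EX0; rewrite unlock /Rintegral => ->.
transitivity (\int[P]_w (pos (X w) * g (V w) - pos (- X w) * g (V w))).
  by apply: eq_Rintegral => w _; rewrite -mulrBl -posB.
rewrite RintegralB//.
rewrite (independent_pair_Rintegral_ge0M mV XV mpos mg)//; last exact: pos_ge0.
rewrite (independent_pair_Rintegral_ge0M mV XV mneg mg)//.
  by rewrite -mulrBl E0 mul0r.
by move=> x; exact: pos_ge0.
Qed.

(** Hoelder's inequality with exponents [q / 2] and [q / m], [q = m + 2]: scale
    [f] by [a] and [g] by [b] in Young's inequality and integrate. *)
Lemma young_Rintegral (f g : T -> R) (a b : R) m :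
  (forall w, 0 <= f w) -> (forall w, 0 <= g w) -> 0 < a -> 0 < b ->
  integrable (fun w => f w ^+ m.+2) -> integrable (fun w => g w ^+ m.+2) ->
  integrable (fun w => f w ^+ 2 * g w ^+ m) ->
  \int[P]_w (f w ^+ m.+2) <= a ^+ m.+2 ->
  \int[P]_w (g w ^+ m.+2) <= b ^+ m.+2 ->
  \int[P]_w (f w ^+ 2 * g w ^+ m) <= a ^+ 2 * b ^+ m.
Proof.
move=> f0 g0 a0 b0 intf intg intfg fa gb.
have a2 : 0 < a ^+ 2 by rewrite exprn_gt0.
have bm : 0 < b ^+ m by rewrite exprn_gt0.
have aq : 0 < a ^+ m.+2 by rewrite exprn_gt0.
have bq : 0 < b ^+ m.+2 by rewrite exprn_gt0.
have le_int :
    \int[P]_w (m.+2%:R / (a ^+ 2 * b ^+ m) * (f w ^+ 2 * g w ^+ m)) <=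
    \int[P]_w (2 / a ^+ m.+2 * f w ^+ m.+2 + m%:R / b ^+ m.+2 * g w ^+ m.+2).
  apply: le_Rintegral => //.
  - exact: integrableZ_EFin.
  - by apply: integrableD_EFin => //; exact: integrableZ_EFin.
  - move=> w _.
    have := @young_sqr_expr _ (f w / a) (g w / b) m.
    rewrite !divr_ge0 ?(ltW a0) ?(ltW b0)// => /(_ isT isT).
    rewrite !expr_div_n (invfM (a ^+ 2)).
    move: (a ^+ 2)^-1 (b ^+ m)^-1 (a ^+ m.+2)^-1 (b ^+ m.+2)^-1 => A2 Bm Aq Bq.
    move: (f w ^+ 2) (g w ^+ m) (f w ^+ m.+2) (g w ^+ m.+2) => F2 Gm Fq Gq.
    move: m.+2%:R m%:R => K k; lra.
move: le_int; rewrite RintegralD//; [|exact: integrableZ_EFin..].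
rewrite !RintegralZl// => le_int.
have h1 : 2 / a ^+ m.+2 * \int[P]_w (f w ^+ m.+2) <= 2.
  by rewrite mulrAC ler_pdivrMr// ler_wpM2l.
have h2 : m%:R / b ^+ m.+2 * \int[P]_w (g w ^+ m.+2) <= m%:R.
  by rewrite mulrAC ler_pdivrMr// ler_wpM2l.
have := le_trans le_int (lerD h1 h2).
rewrite -natrD add2n mulrAC ler_pdivrMr ?mulr_gt0// ler_pM2l ?ltr0n//.
Qed.

End integration.

(** * Moments of the sum and of the Euclidean norm *)

Section moments.
Set Implicit Arguments.
Unset Strict Implicit.
Context (d : measure_display) (T : measurableType d) (R : realType).
Variables (P : probability T R) (n m : nat) (X : 'I_n -> {RV P >-> R}).
Hypothesis indX : mutually_independent X.
Hypothesis cX : forall i, centered (X i).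
Implicit Types (f g : T -> R) (k : nat).

Local Notation integrable f := (P.-integrable [set: T] (EFin \o f)).

Let Y (w : T) : R := \big[Num.max/0]_(i < n) `|X i w|.

Hypothesis intY : integrable (fun w => Y w ^+ m.+2).

Lemma maxnorm_ge i w : `|X i w| <= Y w.
Proof. exact: (le_bigmax_cond _ (fun i => `|X i w|)). Qed.

Lemma maxnorm_ge0 w : 0 <= Y w.
Proof. by apply: bigmax_ge_id. Qed.

(** Closed under the products and powers below, so that integrability of a
    mixed moment comes down to counting degrees. *)
Definition growth k f := measurable_fun [set: T] f /\
  exists2 C : R, 0 <= C & forall w, `|f w| <= C * Y w ^+ k.

Lemma growthM k l f g : growth k f -> growth l g ->
  growth (k + l) (fun w => f w * g w).
Proof.
move=> [mf [C C0 fC]] [mg [D D0 gD]]; split; first exact: measurable_funM.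
exists (C * D); first exact: mulr_ge0.
by move=> w; rewrite normrM exprD mulrACA ler_pM.
Qed.

Lemma growthX k l f : growth k f -> growth (k * l) (fun w => f w ^+ l).
Proof.
move=> [mf [C C0 fC]]; split; first exact: measurable_funX.
exists (C ^+ l); first exact: exprn_ge0.
move=> w; rewrite normrX exprM -exprMn.
by rewrite lerXn2r ?nnegrE ?mulr_ge0 ?exprn_ge0 ?maxnorm_ge0.
Qed.

Lemma growth_sum k (I : finType) (A : pred I) (f : I -> T -> R) :
  (forall i, growth k (f i)) -> growth k (fun w => \sum_(i | A i) f i w).
Proof.
move=> gf; split.
  have -> : (fun w => \sum_(i | A i) f i w) =
      (fun w => \sum_i if A i then f i w else 0).
    by apply/funext => w; rewrite big_mkcond.
  by apply: measurable_sum => i; case: (A i) => //; have [] := gf i.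
have [C C0 fC] : exists2 C : I -> R, forall i, 0 <= C i &
    forall i w, `|f i w| <= C i * Y w ^+ k.
  exists (fun i => sval (cid2 (gf i).2)); first by move=> i; case: cid2.
  by move=> i; case: cid2.
exists (\sum_(i | A i) C i); first by rewrite sumr_ge0.
by move=> w; rewrite mulr_suml (le_trans (ler_norm_sum _ _ _))// ler_sum.
Qed.

(** As [P] is finite, [1 + Y ^+ m.+2] is integrable; it dominates [Y ^+ k]. *)
Lemma growth_integrable k f : (k <= m.+2)%N -> growth k f -> integrable f.
Proof.
move=> kq [mf [C C0 fC]].
have int1 : integrable (fun w => C * (1 + Y w ^+ m.+2)).
  apply: integrableZ_EFin; apply: integrableD_EFin => //.
  exact: finite_measure_integrable_cst.
apply: le_integrable int1 => //; first exact/measurable_EFinP.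
move=> w _; rewrite lee_fin /=.
have Yq : 0 <= Y w ^+ m.+2 by rewrite exprn_ge0 ?maxnorm_ge0.
rewrite [leRHS]ger0_norm ?mulr_ge0 ?addr_ge0// (le_trans (fC w))// ler_wpM2l//.
have [Y1|Y1] := leP (Y w) 1.
  by rewrite (@le_trans _ _ 1) ?lerDl// exprn_ile1// maxnorm_ge0.
by rewrite (@le_trans _ _ (Y w ^+ m.+2)) ?lerDr// ler_weXn2l// ltW.
Qed.

Lemma growth_X i : growth 1 (X i).
Proof.
split=> //; exists 1 => // w.
by rewrite mul1r expr1 maxnorm_ge.
Qed.

Lemma growth_maxnorm : growth 1 Y.
Proof.
split; last by exists 1 => // w; rewrite mul1r expr1 ger0_norm// maxnorm_ge0.
suff mY (s : seq 'I_n) :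
    measurable_fun [set: T] (fun w => \big[Num.max/0]_(i <- s) `|X i w|).
  exact: mY.
elim: s => [|i s IH].
  rewrite [X in measurable_fun _ X](_ : _ = cst 0)//.
  by apply/funext => w; rewrite big_nil.
rewrite [X in measurable_fun _ X](_ : _ =
  (Num.norm \o X i) \max (fun w => \big[Num.max/0]_(j <- s) `|X j w|)).
  by apply: measurable_maxr => //; exact: measurableT_comp.
by apply/funext => w; rewrite big_cons.
Qed.

Lemma growth_pos k f : growth k f -> growth k (fun w => pos (f w)).
Proof.
move=> [mf [C C0 fC]]; split; first exact: measurable_maxr.
exists C => // w; rewrite ger0_norm ?pos_ge0// (le_trans _ (fC w))//.
by rewrite ge_max ler_norm normr_ge0.
Qed.

Lemma measurable_sqrt : measurable_fun [set: R] (@Num.sqrt R).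
Proof. by apply: continuous_measurable_fun; exact: sqrt_continuous. Qed.

Lemma growth_sqrt f : growth 2 f -> growth 1 (fun w => Num.sqrt (f w)).
Proof.
move=> [mf [C C0 fC]]; split; first exact: (measurableT_comp measurable_sqrt).
exists (Num.sqrt C); first exact: sqrtr_ge0.
move=> w; rewrite expr1 ger0_norm ?sqrtr_ge0//.
rewrite -[X in _ * X]ger0_norm ?maxnorm_ge0// -sqrtr_sqr -sqrtrM//.
by rewrite ler_wsqrtr// (le_trans _ (fC w))// ler_norm.
Qed.

Lemma measurable_pos_slope k : measurable_fun [set: R] (@pos_slope R k).
Proof.
apply: measurable_fun_ifT => //; last exact: measurable_funM.
exact: measurable_fun_ltr.
Qed.

Lemma growth_pos_slope k f :
  growth 1 f -> growth k.-1 (fun w => pos_slope k (f w)).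
Proof.
move=> gf; split; first exact: (measurableT_comp (measurable_pos_slope k) gf.1).
have [_ [C C0 fC]] := growthX k.-1 gf.
exists (k%:R * C); first by rewrite mulr_ge0.
move=> w; rewrite ger0_norm ?pos_slope_ge0// /pos_slope -mulrA.
rewrite mul1n in fC.
have YC : 0 <= C * Y w ^+ k.-1 by rewrite mulr_ge0 ?exprn_ge0 ?maxnorm_ge0.
case: ifP => _; last by rewrite mulr_ge0.
by rewrite ler_wpM2l// (le_trans _ (fC w))// ler_norm.
Qed.

Let Z (w : T) : R := \sum_i X i w.
Let S i (w : T) : R := \sum_(j | j != i) X j w.
Let U (w : T) : R := Num.sqrt (\sum_i X i w ^+ 2).
Let V i (w : T) : R := Num.sqrt (\sum_(j | j != i) X j w ^+ 2).
Let v i : R := \int[P]_w (X i w ^+ 2).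
Let s2 : R := \sum_i v i.

Let ZE i w : Z w = S i w + X i w.
Proof. by rewrite /Z (bigD1 i)//= addrC. Qed.

Let gX := growth_X.

Let gZ : growth 1 Z.
Proof. exact: growth_sum. Qed.

Let gS i : growth 1 (S i).
Proof. exact: growth_sum. Qed.

Let gU : growth 1 U.
Proof. by apply/growth_sqrt/growth_sum => i; exact: (growthX 2 (gX i)). Qed.

Let gV i : growth 1 (V i).
Proof. by apply/growth_sqrt/growth_sum => j; exact: (growthX 2 (gX j)). Qed.

Let gpZ k : growth k (fun w => pos (Z w) ^+ k).
Proof. by have := growthX k (growth_pos gZ); rewrite mul1n. Qed.

Let gpS i k : growth k (fun w => pos (S i w) ^+ k).
Proof. by have := growthX k (growth_pos (gS i)); rewrite mul1n. Qed.

Let gUX k : growth k (fun w => U w ^+ k).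
Proof. by have := growthX k gU; rewrite mul1n. Qed.

Let gVX i k : growth k (fun w => V i w ^+ k).
Proof. by have := growthX k (gV i); rewrite mul1n. Qed.

Let gX2 i : growth 2 (fun w => X i w ^+ 2).
Proof. by have := growthX 2 (gX i); rewrite mul1n. Qed.

Let U2 w : U w ^+ 2 = \sum_i X i w ^+ 2.
Proof. by rewrite sqr_sqrtr// sumr_ge0// => i _; exact: sqr_ge0. Qed.

Let U0 w : 0 <= U w. Proof. exact: sqrtr_ge0. Qed.

Let V0 i w : 0 <= V i w. Proof. exact: sqrtr_ge0. Qed.

Let UE i w : U w ^+ 2 = X i w ^+ 2 + V i w ^+ 2.
Proof.
rewrite U2 (bigD1 i)//=; congr (_ + _).
by rewrite sqr_sqrtr// sumr_ge0// => j _; exact: sqr_ge0.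
Qed.

Let v0 i : 0 <= v i.
Proof. by apply: Rintegral_ge0 => w _; exact: sqr_ge0. Qed.

Let indS i : independent_pair P (X i) (S i).
Proof.
exact: (independent_pair_sum_others i indX (@measurable_id _ R setT)).
Qed.

Let mpos : measurable_fun [set: R] (@pos R).
Proof. exact: measurable_maxr. Qed.

Let mX2 : measurable_fun [set: R] (fun x : R => x ^+ 2).
Proof. exact: (@measurable_funX _ _ R setT id 2 (@measurable_id _ _ _)). Qed.

Lemma expectation_mul_pos_others i :
  \int[P]_w (X i w * pos (S i w) ^+ m.+1) = 0.
Proof.
apply: (centered_Rintegral_mul0 (g := fun s => pos s ^+ m.+1) (cX i) (gS i).1
  (indS i)).
- by apply: measurable_funX; exact: mpos.
- by move=> x; rewrite exprn_ge0// pos_ge0.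
- exact: (growth_integrable _ (gpS i m.+1)).
- exact: (growth_integrable _ (growthM (gX i) (gpS i m.+1))).
Qed.

(** Jensen's inequality: integrate the subgradient inequality at [S i], whose
    linear term has mean zero as [X i] is centered and independent of [S i]. *)
Lemma pos_others_le i :
  \int[P]_w (pos (S i w) ^+ m) <= \int[P]_w (pos (Z w) ^+ m).
Proof.
have intS : integrable (fun w => pos (S i w) ^+ m).
  by apply: growth_integrable (gpS i m); rewrite ltnW.
have gc := growth_pos_slope m (gS i).
have mq : (m.-1 <= m)%N by rewrite leq_pred.
have intXc : integrable (fun w => X i w * pos_slope m (S i w)).
  apply: growth_integrable (growthM (gX i) gc).
  by rewrite add1n ltnS (leq_trans mq).
rewrite -[leLHS]addr0.
rewrite -(centered_Rintegral_mul0 (cX i) (gS i).1 (indS i)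
  (measurable_pos_slope m) (pos_slope_ge0 m) _ intXc); last first.
  by apply: growth_integrable gc; rewrite (leq_trans mq)// ltnW.
rewrite -RintegralD//; apply: le_Rintegral => //.
- exact: integrableD_EFin.
- by apply: growth_integrable (gpZ m); rewrite ltnW.
- by move=> w _; rewrite (ZE i); exact: pos_subgradient.
Qed.

Lemma sqr_mul_pos_others_le i :
  \int[P]_w (X i w ^+ 2 * pos (S i w) ^+ m) <=
  v i * \int[P]_w (pos (Z w) ^+ m).
Proof.
rewrite (independent_pair_Rintegral_ge0M (f := fun x => x ^+ 2)
  (g := fun s => pos s ^+ m) (gS i).1 (indS i)).
- by rewrite -/(v i) ler_wpM2l ?v0// pos_others_le.
- exact: mX2.
- by apply: measurable_funX; exact: mpos.
- by move=> x; exact: sqr_ge0.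
- by move=> x; rewrite exprn_ge0// pos_ge0.
- exact: (growth_integrable _ (gX2 i)).
- by apply: growth_integrable (gpS i m); rewrite ltnW.
Qed.

(** Decoupling: the mean-zero products [X i * pos (S i) ^+ m.+1] are
    subtracted from the terms of [Z * pos Z ^+ m.+1 = pos Z ^+ m.+2]. *)
Lemma pos_sum_moment_le :
  \int[P]_w (pos (Z w) ^+ m.+2) <=
  m.+1%:R * (\int[P]_w (U w ^+ 2 * pos (Z w) ^+ m)
             + s2 * \int[P]_w (pos (Z w) ^+ m)).
Proof.
have int1 i : integrable (fun w => X i w * pos (Z w) ^+ m.+1).
  exact: (growth_integrable _ (growthM (gX i) (gpZ m.+1))).
have int2 i : integrable (fun w => X i w * pos (S i w) ^+ m.+1).
  exact: (growth_integrable _ (growthM (gX i) (gpS i m.+1))).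
have int3 i : integrable (fun w => X i w ^+ 2 * pos (Z w) ^+ m).
  exact: (growth_integrable _ (growthM (gX2 i) (gpZ m))).
have int4 i : integrable (fun w => X i w ^+ 2 * pos (S i w) ^+ m).
  exact: (growth_integrable _ (growthM (gX2 i) (gpS i m))).
have -> : \int[P]_w (pos (Z w) ^+ m.+2) =
    \sum_i \int[P]_w (X i w * pos (Z w) ^+ m.+1).
  rewrite -Rintegral_sum//; apply: eq_Rintegral => w _.
  rewrite -mulr_suml -/(Z w) exprS /pos.
  by case: (leP (Z w) 0) => // _; rewrite expr0n mul0r mulr0.
have -> : \int[P]_w (U w ^+ 2 * pos (Z w) ^+ m) =
    \sum_i \int[P]_w (X i w ^+ 2 * pos (Z w) ^+ m).
  by rewrite -Rintegral_sum//; apply: eq_Rintegral => w _; rewrite U2 mulr_suml.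
rewrite /s2 mulr_suml -big_split/= mulr_sumr; apply: ler_sum => i _.
apply: (@le_trans _ _ (m.+1%:R * (\int[P]_w (X i w ^+ 2 * pos (Z w) ^+ m) +
    \int[P]_w (X i w ^+ 2 * pos (S i w) ^+ m)))); last first.
  by rewrite ler_wpM2l// lerD2l sqr_mul_pos_others_le.
rewrite -RintegralD// -RintegralZl//; last exact: integrableD_EFin.
rewrite -[leRHS]add0r -(expectation_mul_pos_others i).
rewrite -RintegralD//; last by apply: integrableZ_EFin; exact: integrableD_EFin.
apply: le_Rintegral => //.
  apply: integrableD_EFin => //; apply: integrableZ_EFin.
  exact: integrableD_EFin.
by move=> w _; rewrite (ZE i); exact: pos_increment.
Qed.

(** After multiplication by [U ^+ 2] each summand is at most
    [m X_i^4 U^m <= m X_i^2 Y^2 U^m], and the [X_i^2] sum to [U^2]. *)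
Lemma euclidean_norm_increment w :
  \sum_i (X i w ^+ 2 * U w ^+ m - X i w ^+ 2 * V i w ^+ m) <=
  m%:R * (Y w ^+ 2 * U w ^+ m).
Proof.
have [U00|Upos] := leP (U w) 0.
  have X0 i : X i w ^+ 2 = 0.
    apply/eqP; rewrite eq_le sqr_ge0 andbT.
    rewrite (@le_trans _ _ (U w ^+ 2))//; first by rewrite (UE i) lerDl sqr_ge0.
    by have -> : U w = 0 by [apply/eqP; rewrite eq_le U00 U0]; rewrite expr0n.
  rewrite big1; first by rewrite !mulr_ge0 ?exprn_ge0 ?maxnorm_ge0.
  by move=> i _; rewrite X0 !mul0r subrr.
have Usq : 0 < U w ^+ 2 by rewrite exprn_gt0.
rewrite -(ler_pM2l Usq).
have -> : U w ^+ 2 * (m%:R * (Y w ^+ 2 * U w ^+ m)) =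
    \sum_i X i w ^+ 2 * (m%:R * (Y w ^+ 2 * U w ^+ m)).
  by rewrite {1}U2 mulr_suml.
rewrite mulr_sumr; apply: ler_sum => i _.
rewrite -mulrBr mulrCA ler_wpM2l ?sqr_ge0//.
apply: (le_trans
  (@norm_increment _ (U w) (V i w) (X i w ^+ 2) m _ _ _ (UE i w))) => //.
  exact: sqr_ge0.
rewrite ler_wpM2l// ler_wpM2r ?exprn_ge0// -real_normK ?num_real//.
by rewrite lerXn2r ?nnegrE ?maxnorm_ge// ?maxnorm_ge0.
Qed.

(** Decoupling for the Euclidean norm: [X i ^+ 2] is independent of [V i], and
    [V i <= U]; the error of replacing [U] by [V i] is the increment above. *)
Lemma euclidean_norm_moment_le :
  \int[P]_w (U w ^+ m.+2) <=
  s2 * \int[P]_w (U w ^+ m) + m%:R * \int[P]_w (Y w ^+ 2 * U w ^+ m).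
Proof.
have int1 i : integrable (fun w => X i w ^+ 2 * U w ^+ m).
  exact: (growth_integrable _ (growthM (gX2 i) (gUX m))).
have int2 i : integrable (fun w => X i w ^+ 2 * V i w ^+ m).
  exact: (growth_integrable _ (growthM (gX2 i) (gVX i m))).
have int3 : integrable (fun w => Y w ^+ 2 * U w ^+ m).
  by apply: (growth_integrable _ (growthM (growthX 2 growth_maxnorm) (gUX m))).
have intU : integrable (fun w => U w ^+ m).
  by apply: growth_integrable (gUX m); rewrite ltnW.
have int4 i :
    integrable (fun w => X i w ^+ 2 * U w ^+ m - X i w ^+ 2 * V i w ^+ m).
  apply: integrableD_EFin => //.
  have := integrableZ_EFin (-1) (int2 i); congr (P.-integrable _ _).
  by apply/funext => w /=; rewrite mulN1r.
have decouple i :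
    \int[P]_w (X i w ^+ 2 * V i w ^+ m) <= v i * \int[P]_w (U w ^+ m).
  have mg : measurable_fun [set: R] (fun t : R => Num.sqrt t ^+ m).
    by apply: measurable_funX; exact: measurable_sqrt.
  rewrite (independent_pair_Rintegral_ge0M (f := fun x => x ^+ 2)
    (g := fun t => Num.sqrt t ^+ m) _
    (independent_pair_sum_others i indX mX2)).
  - rewrite -/(v i) ler_wpM2l ?v0//; apply: le_Rintegral => //.
      by apply: growth_integrable (gVX i m); rewrite ltnW.
    move=> w _; rewrite lerXn2r ?nnegrE ?V0 ?U0//.
    by rewrite -(@ler_pXn2r _ 2) ?nnegrE// ?V0 ?U0// (UE i) lerDr sqr_ge0.
  - exact: (growth_sum (k := 2) _ (fun j => gX2 j)).1.
  - exact: mX2.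
  - exact: mg.
  - by move=> x; exact: sqr_ge0.
  - by move=> x; rewrite exprn_ge0// sqrtr_ge0.
  - exact: (growth_integrable _ (gX2 i)).
  - by apply: growth_integrable (gVX i m); rewrite ltnW.
rewrite -[m%:R * _]RintegralZl//.
have -> : \int[P]_w (U w ^+ m.+2) =
    \sum_i \int[P]_w (X i w ^+ 2 * V i w ^+ m) +
    \int[P]_w (\sum_i (X i w ^+ 2 * U w ^+ m - X i w ^+ 2 * V i w ^+ m)).
  rewrite -Rintegral_sum// -RintegralD//; [|exact: integrable_sum_EFin..].
  apply: eq_Rintegral => w _; rewrite -big_split/=.
  under eq_bigr do rewrite addrC subrK.
  by rewrite -mulr_suml -U2 -exprD.
rewrite lerD//; first by rewrite /s2 mulr_suml ler_sum.
apply: le_Rintegral => //; first exact: integrable_sum_EFin.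
  exact: integrableZ_EFin.
by move=> w _; exact: euclidean_norm_increment.
Qed.

(** The scaling in Hoelder's inequality needs positive norms.  Here the reason
    is that [pos Z] is at most a multiple of [Y]. *)
Lemma maxnorm_moment_gt0 :
  0 < \int[P]_w (pos (Z w) ^+ m.+2) -> 0 < \int[P]_w (Y w ^+ m.+2).
Proof.
have [_ [C C0 ZC]] := gpZ m.+2.
move=> /lt_le_trans Zgt0; have {}Zgt0 := Zgt0 (C * \int[P]_w (Y w ^+ m.+2)).
suff : 0 < C * \int[P]_w (Y w ^+ m.+2).
  by apply: contraTT; rewrite -!leNgt => ?; rewrite mulr_ge0_le0.
apply: Zgt0; rewrite -RintegralZl//; apply: le_Rintegral => //.
- exact: (growth_integrable _ (gpZ m.+2)).
- exact: integrableZ_EFin.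
- by move=> w _; rewrite (le_trans _ (ZC w))// ler_norm.
Qed.

Lemma maxnorm_le_euclidean w : Y w <= U w.
Proof.
apply: bigmax_le => // i _.
by rewrite -sqrtr_sqr ler_wsqrtr// -U2 (UE i) lerDl sqr_ge0.
Qed.

Lemma moment_root (x : R) : 0 < x -> exists2 u : R, 0 < u & u ^+ m.+2 = x.
Proof.
move=> x0; exists (x `^ m.+2%:R^-1); first exact: powR_gt0.
by rewrite -powR_mulrn ?powR_ge0// -powRrM mulVf// powRr1// ltW.
Qed.

(** Hoelder's inequality bounds the mixed moments in the two self-bounding
    relations and, with the constant 1 as first factor, the moments of order
    [m] of [U] and [pos Z]; dividing by [u ^+ m] and [b ^+ m] then leaves
    relations between squared norms. *)
Lemma pos_sum_norm_le (b y : R) : 0 < b -> 0 < y ->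
  \int[P]_w (pos (Z w) ^+ m.+2) = b ^+ m.+2 ->
  \int[P]_w (Y w ^+ m.+2) <= y ^+ m.+2 ->
  b ^+ 2 <= m.+1%:R * (2 * s2 + m%:R * y ^+ 2).
Proof.
move=> b0 y0 Eb Ey.
have intZ := growth_integrable (leqnn _) (gpZ m.+2).
have intU := growth_integrable (leqnn _) (gUX m.+2).
have intone : integrable (fun=> 1 ^+ m.+2 : R).
  exact: finite_measure_integrable_cst.
have Eone : \int[P]_w (1 ^+ m.+2 : R) <= 1 ^+ m.+2.
  by rewrite Rintegral_cst// [X in fine X](probability_setT P) !expr1n mulr1.
have s20 : 0 <= s2 by rewrite sumr_ge0.
have [u u0 Eu] : exists2 u : R, 0 < u & u ^+ m.+2 = \int[P]_w (U w ^+ m.+2).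
  apply: moment_root; apply: (@lt_le_trans _ _ (\int[P]_w (Y w ^+ m.+2))).
    by apply: maxnorm_moment_gt0; rewrite Eb exprn_gt0.
  apply: le_Rintegral => // w _.
  by rewrite lerXn2r ?nnegrE ?maxnorm_ge0 ?U0 ?maxnorm_le_euclidean.
have posn k (z : R) : 0 < z -> 0 < z ^+ k by move=> ?; rewrite exprn_gt0.
have int1X f : growth m (fun w => f w ^+ m) ->
    integrable (fun w => 1 ^+ 2 * f w ^+ m).
  move=> gf; under eq_fun do rewrite expr1n mul1r.
  by apply: growth_integrable gf; rewrite ltnW.
have one_mul f : \int[P]_w (1 ^+ 2 * f w ^+ m) = \int[P]_w (f w ^+ m).
  by apply: eq_Rintegral => w _; rewrite expr1n mul1r.
have pZ0 w : 0 <= pos (Z w) by exact: pos_ge0.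
have YU : u ^+ 2 <= s2 + m%:R * y ^+ 2.
  rewrite -(ler_pM2r (posn m _ u0)) -exprD addnC addn2 Eu.
  apply: (le_trans euclidean_norm_moment_le); rewrite mulrDl -mulrA.
  apply: lerD; rewrite ler_wpM2l//.
    rewrite -one_mul -[leRHS]mul1r -[X in X * _](expr1n _ 2).
    by apply: young_Rintegral => //; [exact: int1X|rewrite Eu].
  apply: young_Rintegral => //; first by move=> w; exact: maxnorm_ge0.
    exact: (growth_integrable _ (growthM (growthX 2 growth_maxnorm) (gUX m))).
  by rewrite Eu.
have ZU : b ^+ 2 <= m.+1%:R * (u ^+ 2 + s2).
  rewrite -(ler_pM2r (posn m _ b0)) -exprD addnC addn2 -Eb.
  apply: (le_trans pos_sum_moment_le); rewrite -mulrA ler_wpM2l//.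
  rewrite mulrDl; apply: lerD.
    apply: young_Rintegral => //; last by rewrite Eb.
      exact: (growth_integrable _ (growthM (gUX 2) (gpZ m))).
    by rewrite Eu.
  rewrite ler_wpM2l// -one_mul -[leRHS]mul1r -[X in X * _](expr1n _ 2).
  by apply: young_Rintegral => //; [exact: int1X|rewrite Eb].
apply: (le_trans ZU); rewrite ler_wpM2l//; lra.
Qed.

End moments.

(** * Norms with a natural exponent, and the theorem *)

Section Lnorm_nat.
Set Implicit Arguments.
Unset Strict Implicit.
Context (d : measure_display) (T : measurableType d) (R : realType).
Variables (P : probability T R) (m : nat) (f : T -> R).
Hypothesis f0 : forall w, 0 <= f w.

Lemma Lnorm_natE :
  Lnorm P m.+2%:R%:E (fun w => (f w)%:E) =
  ((\int[P]_w (f w ^+ m.+2)%:E) `^ m.+2%:R^-1)%E.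
Proof.
rewrite unlock /=; congr (_ `^ _)%E; apply: eq_integral => w _.
by rewrite ger0_norm// powR_mulrn.
Qed.

Lemma Lnorm_nat_fin : P.-integrable [set: T] (EFin \o (fun w => f w ^+ m.+2)) ->
  exists b : R, [/\ 0 <= b, Lnorm P m.+2%:R%:E (fun w => (f w)%:E) = b%:E &
    b ^+ m.+2 = \int[P]_w (f w ^+ m.+2)].
Proof.
move=> intf; have I0 : 0 <= \int[P]_w (f w ^+ m.+2).
  by apply: Rintegral_ge0 => w _; exact: exprn_ge0.
exists ((\int[P]_w (f w ^+ m.+2)) `^ m.+2%:R^-1); split.
- exact: powR_ge0.
- by rewrite Lnorm_natE -poweR_EFin EFin_Rintegral.
- by rewrite -powR_mulrn ?powR_ge0// -powRrM mulVf// powRr1.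
Qed.

Lemma Lnorm_nat_infty : measurable_fun [set: T] f ->
  ~ P.-integrable [set: T] (EFin \o (fun w => f w ^+ m.+2)) ->
  Lnorm P m.+2%:R%:E (fun w => (f w)%:E) = +oo%E.
Proof.
move=> mf nintf; rewrite Lnorm_natE.
suff -> : (\int[P]_w (f w ^+ m.+2)%:E = +oo)%E.
  by rewrite poweRyr// invr_eq0 pnatr_eq0.
apply/eqP; rewrite eq_le leey/= leNgt; apply/negP => fin; apply: nintf.
apply/integrableP; split; first exact/measurable_EFinP/measurable_funX.
apply: le_lt_trans fin; rewrite le_eqVlt; apply/orP; left; apply/eqP.
by apply: eq_integral => w _; rewrite /= ger0_norm// exprn_ge0.
Qed.

End Lnorm_nat.

(** Both terms of the conclusion are nonnegative and their squares dominate
    the two terms of the hypothesis, as [K >= 1] for [K = kappa R]. *)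
Lemma pos_moment_constants (R : realType) (m : nat) (b s2 y theta : R) :
  0 <= s2 -> 0 <= y -> 0 < theta ->
  b ^+ 2 <= m.+1%:R * (2 * s2 + m%:R * y ^+ 2) ->
  b <= Num.sqrt s2 * Num.sqrt (2 * kappa R * (2 + theta) * m.+2%:R)
       + m.+2%:R * kappa R * Num.sqrt (1 + theta^-1) * y.
Proof.
move=> s20 y0 t0 bsy.
move: (kappa R) (kappa_ge1 R) => K k1.
have q0 : 0 <= m%:R :> R by [].
have qE : m.+2%:R = m%:R + 2 :> R by rewrite -natrD addn2.
have q1 : m.+1%:R = m%:R + 1 :> R by rewrite natr1.
have t1 : 0 < theta^-1 by rewrite invr_gt0.
set a := Num.sqrt s2 * _; set c := _ * y.
have a0 : 0 <= a by rewrite mulr_ge0// sqrtr_ge0.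
have c0 : 0 <= c by rewrite !mulr_ge0 ?sqrtr_ge0//; lra.
have a2 : 2 * (m%:R + 1) * s2 <= a ^+ 2.
  rewrite /a exprMn !sqr_sqrtr//; last first.
    by rewrite !mulr_ge0//; lra.
  rewrite mulrC ler_wpM2l// qE.
  have : 2 <= K * (2 + theta) by nra.
  nra.
have c2 : (m%:R + 1) * m%:R * y ^+ 2 <= c ^+ 2.
  rewrite /c !exprMn sqr_sqrtr; last by lra.
  rewrite ler_wpM2r ?sqr_ge0// qE.
  have : 1 <= K ^+ 2 * (1 + theta^-1) by nra.
  nra.
have [b0|b0] := leP b 0; first by rewrite (le_trans b0)// addr_ge0.
rewrite -(@ler_pXn2r _ 2) ?nnegrE ?addr_ge0 ?(ltW b0)//.
move: bsy; rewrite q1; nra.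
Qed.

(* The norms and sigma take values in \bar R, since they may be infinite. As
   the values |X_i| are nonnegative and n > 0, starting the iterated maximum
   at 0 yields the maximum of the |X_i|. *)
Theorem theorem9 (d : measure_display) (T : measurableType d) (R : realType)
    (P : probability T R) (n : nat) (hn : (0 < n)%N)
    (X : 'I_n -> {RV P >-> R})
    (hindep : mutually_independent X)
    (hcentered : forall i : 'I_n, centered (X i)) :
  let Z : T -> R := fun w => \sum_(i < n) X i w in
  let sigma2 : \bar R := (\sum_(i < n) 'E_P[fun w => (X i w ^+ 2)%R])%E in
  let Y : T -> R := fun w => \big[Num.max/0]_(i < n) `|X i w| in
  forall (q : nat) (theta : R), (2 <= q)%N -> 0 < theta -> theta < 1 ->
    (Lnorm P q%:R%:E (fun w => (Num.max (Z w) 0)%:E)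
     <= sqrte sigma2 * (Num.sqrt (2 * kappa R * (2 + theta) * q%:R))%:E
        + (q%:R * kappa R * Num.sqrt (1 + theta^-1))%:E
          * Lnorm P q%:R%:E (fun w => (Y w)%:E))%E.
Proof.
move=> Z sigma2 Y [|[|m]]// theta _ theta0 _.
have Y0 w : 0 <= Y w by exact: maxnorm_ge0.
have mY : measurable_fun [set: T] Y by exact: (growth_maxnorm X).1.
have [intY|nintY] := pselect
  (P.-integrable [set: T] (EFin \o (fun w => Y w ^+ m.+2))); last first.
  rewrite (Lnorm_nat_infty Y0 mY nintY) gt0_muley; last first.
    rewrite lte_fin; apply: mulr_gt0; last first.
      by rewrite sqrtr_gt0 addr_gt0// invr_gt0.
    by rewrite mulr_gt0 ?ltr0n// (lt_le_trans ltr01)// kappa_ge1.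
  rewrite addey ?leey// gt_eqF// (@lt_le_trans _ _ 0%E)//.
  by rewrite mule_ge0 ?sqrte_ge0.
have intX2 i : P.-integrable [set: T] (EFin \o (fun w => X i w ^+ 2)).
  exact: (growth_integrable intY _ (growthX 2 (growth_X X i))).
have gZ : growth X m.+2 (fun w => pos (Z w) ^+ m.+2).
  have := growthX m.+2 (growth_pos (growth_sum predT (growth_X X))).
  by rewrite mul1n.
have intZ := growth_integrable intY (leqnn _) gZ.
pose s2 := \sum_i \int[P]_w (X i w ^+ 2).
have s20 : 0 <= s2.
  by apply: sumr_ge0 => i _; apply: Rintegral_ge0 => w _; exact: sqr_ge0.
have -> : sigma2 = s2%:E.
  rewrite /sigma2 /s2 -sumEFin; apply: eq_bigr => i _.
  by rewrite unlock EFin_Rintegral.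
have [y [y0 -> yE]] := Lnorm_nat_fin Y0 intY.
have [b [b0 bE1 bE]] := Lnorm_nat_fin (fun w => pos_ge0 (Z w)) intZ.
rewrite bE1 /= -!EFinM -EFinD lee_fin.
apply: pos_moment_constants => //.
have [->|bn0] := eqVneq b 0.
  by rewrite expr0n /= mulr_ge0// addr_ge0// mulr_ge0// sqr_ge0.
have bpos : 0 < b by rewrite lt_def bn0.
have ypos : 0 < y.
  rewrite lt_def y0 andbT; apply/eqP => y00.
  have : 0 < \int[P]_w (Y w ^+ m.+2).
    by apply: (maxnorm_moment_gt0 intY); rewrite -bE exprn_gt0.
  by rewrite -yE y00 expr0n ltxx.
apply: (pos_sum_norm_le hindep hcentered intY bpos ypos) => //.
by rewrite yE.
Qed.
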